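(* Let $q$ be a prime power, $n\ge2$, let $C_X,C_Z\subseteq\mathbf{F}_q^n$ be $\mathbf{F}_q$-linear subspaces, and set $C=C_X\times C_Z=\{(\vec a|\vec b):\vec a\in C_X,\vec b\in C_Z\}\subsetneq\mathbf{F}_q^{2n}$, so that $C^{\perp s}=C_Z^{\perp e}\times C_X^{\perp e}$. Assume $C\supsetneq C\cap C^{\perp s}$. Let $\emptyset\neq I\subsetneq K\subseteq\{1,\dots,n\}$ where $K$ is a repair group for $I$, i.e. $\pi_I(C+C^{\perp s})=\pi_I(\sigma_K(C^{\perp s}))$. Let $P$, $J$ and $O$ be produced by the modified reduction procedure described in the context. Then $$|K|-|J|\ \ge\ |P|=\dim\sigma_{K\setminus I}(C_X^{\perp e}\cap C_Z^{\perp e}),$$ and $$|J|-|I|\ \le\ \dim\pi_K(C_X+C_Z)-\dim\sigma_I(\pi_K(C_X+C_Z)).$$ In the special case $C_X=C_Z\subsetneq\mathbf{F}_q^n$, the latter bound becomes $$|J|-|I|\ \le\ \dim\pi_K(C_X)-\dim\sigma_I(C_X^{\perp e}\cap C_X).$$ Moreover, the set of observables $O$ has size $|O|=\dim\pi_I(C^{\perp s})$, which is the smallest possible size of a set of observables for correcting erasures in $I$ by the (entanglement-assisted or unassisted) code $Q(C)$ (with any repair group).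
   Context: Notation. $^{\perp e}$ is the Euclidean dual in $\mathbf{F}_q^n$. For $\vec x=(a_1,\dots,a_m|b_1,\dots,b_m)$, $\vec y=(c_1,\dots,c_m|d_1,\dots,d_m)$ in $\mathbf{F}_q^{2m}$, $\langle \vec x,\vec y\rangle_s=\sum_{i=1}^m (a_id_i-b_ic_i)$; $^{\perp s}$ is the dual for this form; $\operatorname{supp}(\vec x)=\{i:(a_i,b_i)\ne(0,0)\}$. For an index set $K$ and a subspace $S$ of a space of vectors $(a_i)_i$, $\pi_K(S)=\{(a_i)_{i\in K}:\vec a\in S\}$ and $\sigma_K(S)=\{(a_i)_{i\in K}:\vec a\in S,\ a_i=0\text{ for all }i\notin K\}$. For a subspace $S$ of vectors $(\vec a|\vec b)$, $\pi_K(S)=\{((a_i)_{i\in K}|(b_i)_{i\in K}):(\vec a|\vec b)\in S\}$ and $\sigma_K(S)=\{((a_i)_{i\in K}|(b_i)_{i\in K}):(\vec a|\vec b)\in S,\ (a_i,b_i)=(0,0)\text{ for all } i\notin K\}$. In $\sigma_I(\pi_K(S))$ with $I\subseteq K$, the shortening is with respect to the index set $K$. In the procedure below, shortened spaces are regarded as subspaces of the full space $\mathbf{F}_q^{n}$ or $\mathbf{F}_q^{2n}$ by padding zeros. The code $Q(C)$. Let $2c=\dim C^{\perp s}-\dim(C\cap C^{\perp s})$ ($c\ge0$). If $c=0$ put $C'=C$, $\beta=\mathrm{id}$, and $Q(C)$ is the stabilizer code of $C$. If $c>0$, fix an $\mathbf{F}_q$-linear $C'\subseteq\mathbf{F}_q^{2n+2c}$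 (vectors $(a_1,\dots,a_{n+c}|b_1,\dots,b_{n+c})$) with $\dim C'=\dim C+2c$, $\sigma_{\{1,\dots,n\}}(C')=C$, $\pi_{\{1,\dots,n\}}((C')^{\perp s})=C^{\perp s}$, $(C')^{\perp s}\subseteq C'$, and a surjective $\mathbf{F}_p$-linear map $\alpha:C^{\perp s}\to\mathbf{F}_q^{2c}$ ($p$ the characteristic) such that $(C')^{\perp s}$ is the set of vectors $\beta(\vec x)$, $\vec x\in C^{\perp s}$, where $\beta(\vec x)$ has coordinates at indices $1,\dots,n$ given by $\vec x$ and coordinates at indices $n+1,\dots,n+c$ given by $\alpha(\vec x)$ (such $C',\alpha$ exist); $\beta:C^{\perp s}\to(C')^{\perp s}$ is an isomorphism. $Q(C)$ consists of the first $n$ qudits of the stabilizer code of $C'$ on $n+c$ qudits, the last $c$ being held by the decoder without error. Observables. A set of observables is a finite set $T\subseteq(C')^{\perp s}$, of size $|T|$; measuring it for an error $\vec e\in\mathbf{F}_q^{2(n+c)}$ yields the syndromes $\langle\vec e,\vec v\rangle_s$, $\vec v\in T$. It is a set of observables for correcting erasures in $I$ if every $\vec e$ with $\operatorname{supp}(\vec e)\subseteq I$ and $\langle\vec e,\vec v\rangle_s=0$ for all $\vec v\in T$ lies in $(C')^{\perp s}$. The modified reduction procedure. Choose a decomposition $\sigma_K(C^{\perp s})=\sigma_I(C^{\perp s})\oplus\sigma_{K\setminus I}(C^{\perp s})\oplus V$, and let $B_I$, $B_V$ be matrices whose rows are bases of $\sigma_I(C^{\perp s})$ and $V$. Let $W_{XZ}=\sigma_{K\setminus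 I}(C_X^{\perp e}\cap C_Z^{\perp e})$ with generator matrix $B_{WXZ}$ and put $B_W=\begin{pmatrix}B_{WXZ}&\mathbf O\\ \mathbf O&B_{WXZ}\end{pmatrix}$. Greedy step: start with $P=\emptyset$, $C_{\mathrm{sel}}=\emptyset$; run through $\ell\in K\setminus I$ in some order; accept $\ell$ (add $\ell$ to $P$ and $\ell,n+\ell$ to $C_{\mathrm{sel}}$) if column $\ell$ of $B_W$ is not in the span of the columns indexed by $C_{\mathrm{sel}}$ and column $n+\ell$ is not in the span of those columns together with column $\ell$; otherwise discard $\ell$. Elimination step: choose a matrix $M$ such that $\widetilde B_V=B_V-MB_W$ has zero columns at all indices in $C_{\mathrm{sel}}$. Put $J=I\cup\bigcup_{\vec u\in\operatorname{rows}(\widetilde B_V)}\operatorname{supp}(\vec u)$ and $O=\{\beta(\vec u):\vec u\text{ is a row of }B_I\text{ or of }\widetilde B_V\}$. *)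

(* Defs.v *)
From HB Require Import structures.
From mathcomp Require Import all_boot all_order all_algebra.

Set Implicit Arguments.
Unset Strict Implicit.
Unset Printing Implicit Defensive.

Import GRing.Theory.
Local Open Scope ring_scope.

(* A vector (a|b) of F_q^(2m) is [row_mx a b : 'rV[F]_(m + m)]; its halves are
   [lsubmx] and [rsubmx].  Qudits are the elements of ['I_m], qudit [l] having
   the two columns [lshift m l] and [rshift m l].

   Punctured and shortened spaces pi_K(S), sigma_K(S) stay inside the full
   space, padded with zeros outside K.  With this convention sigma_I(pi_K(S))
   is literally [short I (punct K S)] when I is a subset of K. *)

Section Spaces.
Variable F : finFieldType.

Section Plain.
Variable m : nat.
Implicit Types (x y : 'rV[F]_m) (S : {vspace 'rV[F]_m}) (K : {set 'I_m}).

Definition dot x y : F^o := \sum_(i < m) x 0 i * y 0 i.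

Fact dot_is_linear x : linear (dot x).
Proof.
move=> a y z; rewrite /dot scaler_sumr -big_split; apply: eq_bigr => i _ /=.
by rewrite !mxE mulrDr; congr (_ + _); rewrite mulrCA.
Qed.
HB.instance Definition _ x :=
  GRing.isLinear.Build F 'rV[F]_m F^o *:%R (dot x) (dot_is_linear x).

Definition edual S : {vspace 'rV[F]_m} :=
  (\bigcap_(x in S) lker (linfun (dot x)))%VS.

Definition restr K x : 'rV[F]_m := \row_j (if j \in K then x 0 j else 0).

Fact restr_is_linear K : linear (restr K).
Proof.
move=> a x y; apply/rowP=> j; rewrite !mxE.
by case: (j \in K); rewrite // mulr0 addr0.
Qed.
HB.instance Definition _ K :=
  GRing.isLinear.Build F 'rV[F]_m 'rV[F]_m *:%R (restr K) (restr_is_linear K).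

Definition punct K S : {vspace 'rV[F]_m} := (linfun (restr K) @: S)%VS.

Definition short K S : {vspace 'rV[F]_m} :=
  (S :&: lker (linfun (restr (~: K))))%VS.

Lemma edualP S y :
  reflect (forall x, x \in S -> dot x y = 0) (y \in edual S).
Proof.
rewrite memvE; apply: (iffP subv_bigcapP) => h x xS.
  by have := h x xS; rewrite -memvE memv_ker lfunE => /eqP.
by rewrite -memvE memv_ker lfunE /= h.
Qed.

Lemma shortP K S x :
  reflect (x \in S /\ forall i, i \notin K -> x 0 i = 0) (x \in short K S).
Proof.
rewrite memv_cap memv_ker lfunE; apply: (iffP andP) => -[xS h]; split=> //.
  by move=> i iK; move/eqP/rowP/(_ i): h; rewrite !mxE inE iK.
by apply/eqP/rowP=> i; rewrite !mxE inE; case: ifP => // /h.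
Qed.

Lemma punctP K S y :
  reflect (exists2 x, x \in S & y = restr K x) (y \in punct K S).
Proof.
by apply: (iffP memv_imgP) => -[x xS ->]; exists x; rewrite ?lfunE.
Qed.

End Plain.

Section Symplectic.
Variable m : nat.
Implicit Types (x y : 'rV[F]_(m + m)) (S : {vspace 'rV[F]_(m + m)}).
Implicit Types (K : {set 'I_m}).

Definition sympl x y : F^o :=
  \sum_(i < m) (lsubmx x 0 i * rsubmx y 0 i - rsubmx x 0 i * lsubmx y 0 i).

Fact sympl_is_linear x : linear (sympl x).
Proof.
move=> a y z; rewrite /sympl scaler_sumr -big_split; apply: eq_bigr => i _ /=.
rewrite !mxE !mulrDr scalerBr opprD addrACA; congr (_ - _ + _);
  exact: mulrCA.
Qed.
HB.instance Definition _ x :=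
  GRing.isLinear.Build F 'rV[F]_(m + m) F^o *:%R (sympl x) (sympl_is_linear x).

Definition sdual S : {vspace 'rV[F]_(m + m)} :=
  (\bigcap_(x in S) lker (linfun (sympl x)))%VS.

Definition ssupp x : {set 'I_m} :=
  [set i | (lsubmx x 0 i, rsubmx x 0 i) != (0, 0)].

Definition srestr K x : 'rV[F]_(m + m) :=
  row_mx (restr K (lsubmx x)) (restr K (rsubmx x)).

Fact srestr_is_linear K : linear (srestr K).
Proof.
by move=> a x y; rewrite /srestr !linearP scale_row_mx add_row_mx.
Qed.
HB.instance Definition _ K :=
  GRing.isLinear.Build F 'rV[F]_(m + m) 'rV[F]_(m + m) *:%R (srestr K)
    (srestr_is_linear K).

Definition spunct K S : {vspace 'rV[F]_(m + m)} := (linfun (srestr K) @: S)%VS.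

Definition sshort K S : {vspace 'rV[F]_(m + m)} :=
  (S :&: lker (linfun (srestr (~: K))))%VS.

Definition prod_code (CX CZ : {vspace 'rV[F]_m}) : {vspace 'rV[F]_(m + m)} :=
  (linfun lsubmx @^-1: CX :&: linfun rsubmx @^-1: CZ)%VS.

Lemma sdualP S y :
  reflect (forall x, x \in S -> sympl x y = 0) (y \in sdual S).
Proof.
rewrite memvE; apply: (iffP subv_bigcapP) => h x xS.
  by have := h x xS; rewrite -memvE memv_ker lfunE => /eqP.
by rewrite -memvE memv_ker lfunE /= h.
Qed.

Lemma sshortP K S x :
  reflect (x \in S /\ ssupp x \subset K) (x \in sshort K S).
Proof.
rewrite memv_cap memv_ker lfunE; apply: (iffP andP) => -[xS h]; split=> //.
  apply/subsetP=> i; rewrite inE; apply: contraNT => iK.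
  move: h; rewrite /= /srestr -row_mx0 => /eqP/eq_row_mx[/rowP hl /rowP hr].
  by have := hl i; have := hr i; rewrite !mxE inE iK => -> ->.
rewrite /= /srestr -[X in _ == X]row_mx0; apply/eqP; congr row_mx;
  apply/rowP=> i; rewrite !mxE inE; case: ifP => // iK;
  have := contraNN (subsetP h i) iK; rewrite inE negbK xpair_eqE !mxE;
  by case/andP=> /eqP ? /eqP ?.
Qed.

Lemma spunctP K S y :
  reflect (exists2 x, x \in S & y = srestr K x) (y \in spunct K S).
Proof.
by apply: (iffP memv_imgP) => -[x xS ->]; exists x; rewrite ?lfunE.
Qed.

Lemma mem_prod_code CX CZ x :
  (x \in prod_code CX CZ) = (lsubmx x \in CX) && (rsubmx x \in CZ).
Proof. by rewrite memv_cap -!memv_preim !lfunE. Qed.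

Lemma sdual_prod_code CX CZ :
  sdual (prod_code CX CZ) = prod_code (edual CZ) (edual CX).
Proof.
apply/vspaceP=> y; rewrite mem_prod_code; apply/sdualP/andP => [h|[hl hr]].
  split; apply/edualP => x xC.
    have := h (row_mx 0 x); rewrite mem_prod_code row_mxKl row_mxKr mem0v xC.
    move=> /(_ isT) /eqP; rewrite /sympl row_mxKl row_mxKr.
    rewrite (eq_bigr (fun i => - (x 0 i * lsubmx y 0 i))); last first.
      by move=> i _; rewrite mxE mul0r sub0r.
    by rewrite sumrN oppr_eq0 => /eqP.
  have := h (row_mx x 0); rewrite mem_prod_code row_mxKl row_mxKr mem0v xC.
  move=> /(_ isT); rewrite /sympl row_mxKl row_mxKr => <-.
  by apply: eq_bigr => i _; rewrite [X in _ - X * _]mxE mul0r subr0.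
move=> x; rewrite mem_prod_code => /andP[xl xr].
by rewrite /sympl sumrB [X in X - _](edualP _ _ hr) //
  [X in _ - X](edualP _ _ hl) // subrr.
Qed.

End Symplectic.

Section EntanglementAssisted.
Variables n c : nat.
Implicit Types (C : {vspace 'rV[F]_(n + n)}).
Implicit Types (Ce : {vspace 'rV[F]_((n + c) + (n + c))}).
Implicit Types (alpha : 'rV[F]_(n + n) -> 'rV[F]_(c + c)).

(* restriction to the first n qudits *)
Definition firstq (x : 'rV[F]_((n + c) + (n + c))) : 'rV[F]_(n + n) :=
  row_mx (lsubmx (lsubmx x)) (lsubmx (rsubmx x)).

Definition beta alpha (x : 'rV[F]_(n + n)) : 'rV[F]_((n + c) + (n + c)) :=
  row_mx (row_mx (lsubmx x) (lsubmx (alpha x)))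
         (row_mx (rsubmx x) (rsubmx (alpha x))).

Fact firstq_is_linear : linear firstq.
Proof.
by move=> a x y; rewrite /firstq !linearP scale_row_mx add_row_mx.
Qed.
HB.instance Definition _ :=
  GRing.isLinear.Build F 'rV[F]_((n + c) + (n + c)) 'rV[F]_(n + n) *:%R firstq
    firstq_is_linear.

(* For c = 0 this says that beta is the identity. *)
Lemma firstq_beta alpha x : firstq (beta alpha x) = x.
Proof. by rewrite /firstq /beta !(row_mxKl, row_mxKr) hsubmxK. Qed.

Definition qfirst : {set 'I_(n + c)} := [set lshift c i | i : 'I_n].

(* The elements of the prime field F_p are the k%:R. *)
Definition Fp_linear_on C alpha : Prop :=
  {in C &, forall x y, alpha (x + y) = alpha x + alpha y} /\
  {in C, forall x (k : nat), alpha (k%:R *: x) = k%:R *: alpha x}.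

(* The data (c, C', alpha) fixed in the construction of Q(C), with [Ce] for C'.
   Only the values of [alpha] on [sdual C] are relevant.  When c = 0, [firstq]
   is the canonical identification of F_q^(2(n + 0)) with F_q^(2n), so the first
   case reads C' = C; there [alpha] takes its values in the zero space. *)
Definition EA_extension C Ce alpha : Prop :=
  (2 * c = \dim (sdual C) - \dim (C :&: sdual C))%N /\
  if c == 0%N then forall x, (x \in Ce) = (firstq x \in C) else
  [/\ \dim Ce = (\dim C + 2 * c)%N,
      (linfun firstq @: sshort qfirst Ce = C)%VS,
      (linfun firstq @: sdual Ce = sdual C)%VS
    & (sdual Ce <= Ce)%VS] /\
  [/\ Fp_linear_on (sdual C) alpha,
      forall z, exists2 x, x \in sdual C & alpha x = z
    & forall y, y \in sdual Ce <-> exists2 x, x \in sdual C & y = beta alpha x].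

(* Erasures occur in the first n qudits only. *)
Definition erasure_observables (I : {set 'I_n}) Ce
    (T : {set 'rV[F]_((n + c) + (n + c))}) : Prop :=
  {subset T <= sdual Ce} /\
  forall e : 'rV[F]_((n + c) + (n + c)),
    ssupp e \subset [set lshift c i | i in I] ->
    {in T, forall v, sympl e v = 0} -> e \in sdual Ce.

End EntanglementAssisted.

Section Procedure.
Variable n : nat.

Definition rows_basis (r m : nat) (B : 'M[F]_(r, m)) (S : {vspace 'rV[F]_m}) :=
  basis_of S [seq row i B | i <- enum 'I_r].

Definition in_col_span (r m : nat) (B : 'M[F]_(r, m)) (j : 'I_m)
    (A : {set 'I_m}) : bool :=
  col j B \in <<[seq col k B | k <- enum A]>>%VS.

Definition greedy_step (r : nat) (B : 'M[F]_(r, n + n))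
    (st : {set 'I_n} * {set 'I_(n + n)}) (l : 'I_n) :=
  let: (P, Csel) := st in
  if ~~ in_col_span B (lshift n l) Csel &&
     ~~ in_col_span B (rshift n l) (lshift n l |: Csel)
  then (l |: P, lshift n l |: (rshift n l |: Csel))
  else (P, Csel).

Definition greedy (r : nat) (B : 'M[F]_(r, n + n)) (s : seq 'I_n) :=
  foldl (greedy_step B) (set0, set0) s.

(* [reduction CX CZ I K b P J O]: some run of the modified reduction procedure,
   with some choice of V, of the bases, of the order [s] and of [M], outputs
   P, J and O; [b] plays the role of the map beta. *)
Inductive reduction (N : nat) (CX CZ : {vspace 'rV[F]_n}) (I K : {set 'I_n})
    (b : 'rV[F]_(n + n) -> 'rV[F]_N) :
    {set 'I_n} -> {set 'I_n} -> {set 'rV[F]_N} -> Prop :=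
| Reduction (rI rV rW : nat) (V : {vspace 'rV[F]_(n + n)})
    (BI : 'M[F]_(rI, n + n)) (BV : 'M[F]_(rV, n + n)) (BWXZ : 'M[F]_(rW, n))
    (s : seq 'I_n) (M : 'M[F]_(rV, rW + rW)) :
    let Cd := sdual (prod_code CX CZ) in
    let BW := block_mx BWXZ 0 0 BWXZ in
    let P := (greedy BW s).1 in
    let Csel := (greedy BW s).2 in
    let BVt := BV - M *m BW in
    let J := I :|: \bigcup_(i < rV) ssupp (row i BVt) in
    let O := [set b (row i BI) | i : 'I_rI] :|: [set b (row i BVt) | i : 'I_rV]
    in
    (sshort I Cd + sshort (K :\: I) Cd + V)%VS = sshort K Cd ->
    directv (sshort I Cd + sshort (K :\: I) Cd + V) ->
    rows_basis BI (sshort I Cd) ->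
    rows_basis BV V ->
    rows_basis BWXZ (short (K :\: I) (edual CX :&: edual CZ)) ->
    perm_eq s (enum (K :\: I)) ->
    (forall j, j \in Csel -> col j BVt = 0) ->
    reduction CX CZ I K b P J O.

End Procedure.

End Spaces.

(* Main.v *)
Require Import Defs.
From HB Require Import structures.
From mathcomp Require Import all_boot all_order all_algebra.
From mathcomp Require Import zify.

(* Writing D = C^perp, the greedy step computes a column basis of B_WXZ, so
   |P| = dim sigma_(K\I)(C_X^perp :&: C_Z^perp), and the elimination step makes
   J avoid P.  This gives |J| - |I| <= |K\I| - |P|, which duality between
   puncturing and shortening turns into dim pi_(K\I)(C_X + C_Z).  The rows of
   B_I and of the reduced B_V form a basis of a complement of sigma_(K\I)(D) in
   sigma_K(D), so |O| = dim pi_I(sigma_K(D)) = dim pi_I(D).  An error e in I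
   orthogonal to O is orthogonal to sigma_K(D), hence to C + D because I is
   repaired by K, and pi_n(C') = C + D puts e in (C')^perp.  Conversely, errors
   in I undetected by T must lie in D^perp, and comparing dimensions bounds |T|. *)

Set Implicit Arguments.
Unset Strict Implicit.
Unset Printing Implicit Defensive.

Import GRing.Theory Num.Theory.
Local Open Scope ring_scope.

(** * Spans of families of vectors and of matrix columns *)

Section LinearAlgebra.
Variable F : fieldType.

Lemma linear_span_mem (U V : vectType F) (f : {linear U -> V}) (X : seq U)
    (W : {vspace V}) (x : U) :
  {in X, forall y, f y \in W} -> x \in <<X>>%VS -> f x \in W.
Proof.
move=> fXW xX; have /subvP/(_ x xX) : (<<X>> <= linfun f @^-1: W)%VS.
  by apply/span_subvP => y /fXW fy; rewrite -memv_preim lfunE.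
by rewrite -memv_preim lfunE.
Qed.

Lemma dim_span_adjoin (V : vectType F) (U : {vspace V}) (v : V) :
  v \notin U -> (\dim U < \dim (<[v]> + U))%N.
Proof.
move=> vU; rewrite ltn_neqAle (dimvS (addvSr _ _)) andbT.
apply: contra vU => /eqP dU; rewrite memvE.
have /eqP -> : U == (<[v]> + U)%VS by rewrite eqEdim addvSr dU leqnn.
exact: addvSl.
Qed.

Lemma basis_row_free (r m : nat) (B : 'M[F]_(r, m)) :
  free [seq row i B | i <- enum 'I_r] -> row_free B.
Proof.
move=> fB; apply: inj_row_free => v vB0.
have fB' : free [tuple row i B | i < r] by [].
apply/rowP => i; rewrite mxE; apply: (freeP fB' (fun j => v 0 j)).
rewrite -[RHS]vB0 mulmx_sum_row; apply: eq_bigr => j _.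
by rewrite -tnth_nth tnth_mktuple.
Qed.

Definition cspan (r m : nat) (B : 'M[F]_(r, m)) (A : {set 'I_m}) :=
  <<[seq col k B | k <- enum A]>>%VS.

Lemma mem_cspan r m (B : 'M[F]_(r, m)) (A : {set 'I_m}) k :
  k \in A -> col k B \in cspan B A.
Proof. by move=> kA; apply/memv_span/map_f; rewrite mem_enum. Qed.

Lemma cspanP r m (B : 'M[F]_(r, m)) (A : {set 'I_m}) (U : {vspace 'cV[F]_r}) :
  reflect {in A, forall k, col k B \in U} (cspan B A <= U)%VS.
Proof.
apply: (iffP span_subvP) => [h k kA | h x /mapP[k]].
  by apply/h/map_f; rewrite mem_enum.
by rewrite mem_enum => /h kU ->.
Qed.

Lemma cspanU1 r m (B : 'M[F]_(r, m)) l (A : {set 'I_m}) :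
  cspan B (l |: A) = (<[col l B]> + cspan B A)%VS.
Proof.
apply/eqP; rewrite eqEsubv subv_add; apply/and3P; split.
- apply/cspanP => k /setU1P[->|kA].
    exact/(subvP (addvSl _ _))/memv_line.
  exact/(subvP (addvSr _ _))/mem_cspan.
- exact/mem_cspan/setU11.
- by apply/cspanP => k kA; apply/mem_cspan/setU1r.
Qed.

(** A right inverse [B'] of [B] gives [x = B *m (B' *m x)], which expresses any [x] as a combination
    of columns of [B]. *)
Lemma cspan_row_free r m (B : 'M[F]_(r, m)) :
  row_free B -> cspan B setT = fullv.
Proof.
case/row_freeP => B' BB'; apply/vspaceP => x; rewrite memvf.
rewrite -[x]mul1mx -BB' -mulmxA -[B *m _]trmxK trmx_mul mulmx_sum_row.
rewrite linear_sum; apply: memv_suml => k _.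
by rewrite linearZ /= -tr_col trmxK rpredZ // mem_cspan ?inE.
Qed.

End LinearAlgebra.

(** * Euclidean duality between puncturing and shortening *)

Section Duality.
Variables (F : finFieldType) (m : nat).
Implicit Types (S T : {vspace 'rV[F]_m}) (K A : {set 'I_m}) (x y : 'rV[F]_m).

(** Rank-nullity for the map sending [x] to its products with a basis of [S]. Its kernel is the
    dual, and it is onto because the matrix of the basis has a right inverse. *)
Lemma dim_edual S : (\dim (edual S) + \dim S = m)%N.
Proof.
pose B := \matrix_i (vbasis S)`_i : 'M[F]_(\dim S, m).
have rB i : row i B = (vbasis S)`_i by rewrite rowK.
have fB : row_free B.
  apply: inj_row_free => v vB0; apply/rowP => i; rewrite mxE.
  apply: (freeP (basis_free (vbasisP S)) (fun j => v 0 j)).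
  by rewrite -[RHS]vB0 mulmx_sum_row; apply: eq_bigr => j _; rewrite rB.
pose f : 'Hom('rV[F]_m, 'rV[F]_(\dim S)) := linfun (mulmxr B^T).
have fE x i : f x 0 i = dot (vbasis S)`_i x.
  rewrite lfunE /= /dot !mxE; apply: eq_bigr => j _.
  by rewrite -rB !mxE mulrC.
have kerf : lker f = edual S.
  apply/vspaceP => x; rewrite memv_ker; apply/eqP/edualP => [fx0 y yS|xS].
    rewrite (coord_vbasis yS) /dot.
    under eq_bigr do rewrite summxE mulr_suml.
    rewrite exchange_big big1 // => i _.
    under eq_bigr do rewrite mxE -mulrA.
    by rewrite -mulr_sumr -[X in _ * X]/(dot _ _) -fE fx0 mxE mulr0.
  apply/rowP => i; rewrite fE mxE xS // vbasis_mem ?mem_nth //.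
  by rewrite size_tuple.
have imf : limg f = fullv.
  apply/vspaceP => y; rewrite memvf; apply/memv_imgP.
  have [B' BB'] := row_freeP fB; exists (y *m B'^T); first exact: memvf.
  by rewrite lfunE /= -mulmxA -trmx_mul BB' trmx1 mulmx1.
have := limg_ker_dim f fullv; rewrite capfv kerf imf !dimvf /dim /=.
by rewrite !mul1n.
Qed.

Lemma restr_decomp K x : x = restr K x + restr (~: K) x.
Proof.
by apply/rowP => i; rewrite !mxE inE; case: (i \in K); rewrite ?addr0 ?add0r.
Qed.

Lemma restr_notin K x i : i \notin K -> restr K x 0 i = 0.
Proof. by rewrite mxE => /negPf ->. Qed.

Lemma dim_short_fullv K : \dim (short K (fullv : {vspace 'rV[F]_m})) = #|K|.
Proof.
have le A : (\dim (short A (fullv : {vspace 'rV[F]_m})) <= #|A|)%N.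
  pose X : seq 'rV[F]_m := [seq delta_mx 0 i | i <- enum A].
  have -> : #|A| = size X by rewrite size_map -cardE.
  apply/(leq_trans _ (dim_span X))/dimvS/subvP => x /shortP[_ x0].
  rewrite [x]row_sum_delta memv_suml // => i _.
  have [iA|/x0->] := boolP (i \in A); last by rewrite scale0r mem0v.
  by rewrite rpredZ // memv_span // map_f // mem_enum.
pose E : {vspace 'rV[F]_m} := fullv.
(* Every vector splits into its restrictions to [K] and to [~: K], so the upper bounds [le] for
   these two sets, which add up to [m], must both be attained. *)
have : (m <= \dim (short K E) + \dim (short (~: K) E))%N.
  have dm : \dim E = m by rewrite dimvf /dim /= mul1n.
  rewrite -{1}dm.
  apply: leq_trans (leq_of_leqif (dimv_add_leqif _ _)).
  apply/dimvS/subvP => x _; rewrite [x](restr_decomp K) memv_add //;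
  apply/shortP; split; rewrite ?memvf //; exact: restr_notin.
have := le K; have := le (~: K); rewrite -/E.
have := cardsC K; rewrite card_ord; lia.
Qed.

Lemma dotC x y : dot x y = dot y x.
Proof. by apply: eq_bigr => i _; rewrite mulrC. Qed.

Lemma edualD S T : edual (S + T) = (edual S :&: edual T)%VS.
Proof.
apply/vspaceP => x; rewrite memv_cap.
apply/edualP/andP => [xST|[/edualP xS /edualP xT] _ /memv_addP[y yS [z zT ->]]].
  by split; apply/edualP => y yST; apply: xST;
    [apply/(subvP (addvSl _ _)) | apply/(subvP (addvSr _ _))].
by rewrite dotC linearD /= dotC xS // dotC xT // addr0.
Qed.

Lemma dot_restr K x y : dot (restr K x) y = dot x (restr K y).
Proof.
by apply: eq_bigr => i _; rewrite !mxE; case: ifP; rewrite ?mulr0 ?mul0r.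
Qed.

Lemma restr_id K x : (forall i, i \notin K -> x 0 i = 0) -> restr K x = x.
Proof. by move=> x0; apply/rowP => i; rewrite mxE; case: ifPn => // /x0. Qed.

(* The orthogonal of pi_K(S) in the full space is
   sigma_K(S^perp) plus everything supported off K. *)
Lemma dim_short_edual K S :
  (\dim (short K (edual S)) + \dim (punct K S) = #|K|)%N.
Proof.
have := limg_ker_dim (linfun (restr K)) (edual (punct K S)).
have -> : (edual (punct K S) :&: lker (linfun (restr K)) =
    short (~: K) (fullv : {vspace 'rV[F]_m}))%VS.
  apply/vspaceP => x; rewrite memv_cap memv_ker lfunE /=.
  apply/andP/shortP => [[_ /eqP/rowP x0]|[_ x0]].
    split=> [|i]; first exact: memvf.
    by rewrite inE negbK => iK; have := x0 i; rewrite !mxE iK.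
  have rx0 : restr K x = 0.
    by apply/rowP => i; rewrite !mxE; case: ifP => // iK; rewrite x0 ?inE ?iK.
  split; last exact/eqP.
  by apply/edualP => _ /punctP[y _ ->]; rewrite dot_restr rx0 linear0.
have -> : (linfun (restr K) @: edual (punct K S) = short K (edual S))%VS.
  apply/vspaceP => x; apply/memv_imgP/shortP => [[y /edualP yS ->]|[xS x0]].
    rewrite lfunE; split; last exact: restr_notin.
    apply/edualP => z zS; rewrite /= -dot_restr; apply: yS.
    by apply/punctP; exists z.
  exists x; last by rewrite lfunE /= restr_id.
  apply/edualP => _ /punctP[y yS ->]; rewrite dot_restr restr_id //.
  by move/edualP: xS; apply.
rewrite dim_short_fullv => dS; apply: (@addnI #|~: K|).
by rewrite addnA dS dim_edual [RHS]addnC cardsC card_ord.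
Qed.

End Duality.

(** * Symplectic duality, reduced to the Euclidean case *)

Section SymplecticDuality.
Variables (F : finFieldType) (m : nat).
Implicit Types (S : {vspace 'rV[F]_(m + m)}) (K A : {set 'I_m}).
Implicit Types (x y : 'rV[F]_(m + m)).

(** Through this set, [srestr], [spunct] and [sshort] over qudits become the plain operations over
    columns. *)
Definition qudit_cols A : {set 'I_(m + m)} :=
  [set lshift m i | i in A] :|: [set rshift m i | i in A].

Lemma lshift_qudit_cols A i : (lshift m i \in qudit_cols A) = (i \in A).
Proof.
rewrite inE (mem_imset _ _ (@lshift_inj _ _)) orbC.
by case: imsetP => // -[j _ /eqP]; rewrite eq_lrshift.
Qed.

Lemma rshift_qudit_cols A i : (rshift m i \in qudit_cols A) = (i \in A).
Proof.
rewrite inE (mem_imset _ _ (@rshift_inj _ _)).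
by case: imsetP => // -[j _ /eqP]; rewrite eq_rlshift.
Qed.

Lemma card_qudit_cols A : #|qudit_cols A| = (#|A| + #|A|)%N.
Proof.
rewrite cardsU !card_imset; [|exact: rshift_inj|exact: lshift_inj].
rewrite (_ : _ :&: _ = set0) ?cards0 ?subn0 //; apply/setP => j; rewrite !inE.
apply/negP => /andP[/imsetP[i _ ->] /imsetP[k _ /eqP]].
by rewrite eq_lrshift.
Qed.

Lemma srestrE K x : srestr K x = restr (qudit_cols K) x.
Proof.
apply/rowP => j; case: (split_ordP j) => i ->.
  by rewrite row_mxEl !mxE lshift_qudit_cols.
by rewrite row_mxEr !mxE rshift_qudit_cols.
Qed.

Lemma spunctE K S : spunct K S = punct (qudit_cols K) S.
Proof.
apply/vspaceP => x; apply/spunctP/punctP => -[y yS ->]; exists y => //;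
by rewrite srestrE.
Qed.

Lemma ssuppPn x i : reflect (x 0 (lshift m i) = 0 /\ x 0 (rshift m i) = 0)
  (i \notin ssupp x).
Proof.
rewrite inE negbK xpair_eqE !mxE.
by apply: (iffP andP) => -[/eqP xl /eqP xr]; split => //; apply/eqP.
Qed.

Lemma ssupp_sub K x : reflect
    (forall i, i \notin K -> x 0 (lshift m i) = 0 /\ x 0 (rshift m i) = 0)
  (ssupp x \subset K).
Proof.
apply: (iffP subsetP) => [h i iK|h i].
  by apply/ssuppPn; apply: contra iK; apply: h.
by apply: contraLR => /h/ssuppPn.
Qed.

Lemma sshortE K S : sshort K S = short (qudit_cols K) S.
Proof.
apply/vspaceP => x; apply/sshortP/shortP => -[xS h]; split => //.
  move=> j; case: (split_ordP j) => i ->.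
    by rewrite lshift_qudit_cols => iK; have [] := ssupp_sub _ _ h i iK.
  by rewrite rshift_qudit_cols => iK; have [] := ssupp_sub _ _ h i iK.
apply/ssupp_sub => i iK.
by rewrite !h ?lshift_qudit_cols ?rshift_qudit_cols.
Qed.

Lemma symplC x y : sympl x y = - sympl y x.
Proof.
rewrite /sympl -sumrN; apply: eq_bigr => i _; rewrite opprB.
by rewrite [X in X - _]mulrC [X in _ - X]mulrC.
Qed.

(** The isometry (a|b) -> (b|-a), which turns the symplectic form into the dot product; its inverse
    is its negative. *)
Definition twist x : 'rV[F]_(m + m) := row_mx (rsubmx x) (- lsubmx x).

Fact twist_is_linear : linear twist.
Proof.
by move=> a x y; rewrite /twist !linearP /= scale_row_mx add_row_mx scalerN.
Qed.
HB.instance Definition _ :=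
  GRing.isLinear.Build F 'rV[F]_(m + m) 'rV[F]_(m + m) *:%R twist
    twist_is_linear.

Lemma dot_twist x y : dot x (twist y) = sympl x y.
Proof.
rewrite [LHS]big_split_ord /= -[LHS]big_split; apply: eq_bigr => i _ /=.
by rewrite row_mxEl row_mxEr !mxE mulrN.
Qed.

(** Since [twist] only exchanges, up to sign, the two columns of each qudit, it respects supports
    and carries the shortened symplectic dual bijectively onto the shortened Euclidean dual. *)
Lemma dim_sshort_sdual K S :
  (\dim (sshort K (sdual S)) + \dim (spunct K S) = #|K| + #|K|)%N.
Proof.
rewrite -card_qudit_cols -(dim_short_edual (qudit_cols K) S) spunctE.
congr (_ + _)%N.
have <- : (linfun twist @: sshort K (sdual S) =
    short (qudit_cols K) (edual S))%VS.
  apply/vspaceP => x; apply/memv_imgP/idP => [[y]|].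
    rewrite sshortE => /shortP[/sdualP yS y0] ->; rewrite lfunE /=.
    apply/shortP; split; first by apply/edualP => z /yS; rewrite dot_twist.
    move=> j; case: (split_ordP j) => i ->.
      rewrite lshift_qudit_cols row_mxEl mxE => iK.
      by rewrite y0 ?rshift_qudit_cols.
    rewrite rshift_qudit_cols row_mxEr !mxE => iK.
    by rewrite y0 ?lshift_qudit_cols ?oppr0.
  case/shortP => /edualP xS x0.
  have tK : x = twist (- twist x).
    by rewrite linearN /= /twist !row_mxKl !row_mxKr opp_row_mx !opprK hsubmxK.
  exists (- twist x); last by rewrite lfunE.
  rewrite sshortE; apply/shortP; split.
    by apply/sdualP => z zS; rewrite -dot_twist -tK xS.
  move=> j; case: (split_ordP j) => i ->.
    rewrite lshift_qudit_cols mxE row_mxEl mxE => iK.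
    by rewrite x0 ?rshift_qudit_cols ?oppr0.
  rewrite rshift_qudit_cols mxE row_mxEr !mxE => iK.
  by rewrite x0 ?lshift_qudit_cols ?opprK.
rewrite limg_dim_eq //; apply/eqP; rewrite -subv0; apply/subvP => x.
rewrite memv_cap memv_ker lfunE memv0 => /andP[_ /eqP].
rewrite /= /twist -row_mx0 => /eq_row_mx[r0 /eqP]; rewrite oppr_eq0 => /eqP l0.
by rewrite -[x]hsubmxK r0 l0 row_mx0.
Qed.

End SymplecticDuality.

(** * Dimension formulas for combined puncturing and shortening *)

Section ShortenPuncture.
Variables (F : finFieldType) (m : nat).
Implicit Types (I K : {set 'I_m}).

(** Rank-nullity for restriction to [K :\: I] on the punctured space: the kernel consists of the
    words living on [I]. *)
Lemma dim_short_punct I K (S : {vspace 'rV[F]_m}) : I \subset K ->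
  (\dim (short I (punct K S)) + \dim (punct (K :\: I) S) =
    \dim (punct K S))%N.
Proof.
move/subsetP => IK.
rewrite -(limg_ker_dim (linfun (restr (K :\: I))) (punct K S)).
congr addn; congr (dimv _); apply/vspaceP => x.
  rewrite [RHS]memv_cap memv_ker lfunE /=.
  apply/shortP/andP => -[xS]; move: (xS) => /punctP[y _ xE].
    move=> x0; split=> //; apply/eqP/rowP => i; rewrite !mxE inE.
    by case: ifP => // /andP[/x0].
  move=> /eqP/rowP x0; split=> // i iI; have := x0 i; rewrite !mxE inE iI /=.
  by case: ifPn => // iK _; rewrite xE restr_notin.
have rr y : restr (K :\: I) (restr K y) = restr (K :\: I) y.
  by apply/rowP => i; rewrite !mxE inE; case: (i \in K); rewrite ?andbF.
apply/punctP/memv_imgP => [[y yS ->]|[_ /punctP[y yS ->] ->]].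
  by exists (restr K y); [apply/punctP; exists y | rewrite lfunE /= rr].
by exists y; rewrite ?lfunE /= ?rr.
Qed.

Lemma short_punct_sub I K (S : {vspace 'rV[F]_m}) : I \subset K ->
  (short I S <= short I (punct K S))%VS.
Proof.
move=> /subsetP IK; apply/subvP => x /shortP[xS x0]; apply/shortP; split=> //.
apply/punctP; exists x => //; rewrite restr_id // => i iK; apply: x0.
exact: contra (IK i) iK.
Qed.

Lemma srestr_eq0 K (x : 'rV[F]_(m + m)) :
  reflect (forall i, i \in K -> x 0 (lshift m i) = 0 /\ x 0 (rshift m i) = 0)
    (srestr K x == 0).
Proof.
rewrite /srestr -[X in _ == X]row_mx0.
apply: (iffP eqP) => [/eq_row_mx[/rowP xl /rowP xr] i iK|x0].
  by have := xl i; have := xr i; rewrite !mxE iK.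
by congr row_mx; apply/rowP => i; rewrite !mxE; case: ifP => // /x0[].
Qed.

(** Rank-nullity for restriction to [I] on [sshort K S]: the words it kills are those supported on
    [K :\: I]. *)
Lemma dim_sshortD I K (S : {vspace 'rV[F]_(m + m)}) :
  (\dim (sshort (K :\: I) S) + \dim (spunct I (sshort K S)) =
    \dim (sshort K S))%N.
Proof.
rewrite -(limg_ker_dim (linfun (srestr I)) (sshort K S)).
congr addn; congr (dimv _); apply/vspaceP => x.
rewrite [RHS]memv_cap memv_ker lfunE /=.
apply/sshortP/andP => [[xS /ssupp_sub x0]|[]].
  split; last by apply/srestr_eq0 => i iI; apply: x0; rewrite inE iI.
  apply/sshortP; split=> //; apply/ssupp_sub => i iK; apply: x0.
  by rewrite inE negb_and iK orbT.
move=> /sshortP[xS /ssupp_sub xK] /srestr_eq0 xI; split=> //.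
apply/ssupp_sub => i; rewrite inE negb_and negbK.
by case/orP => [/xI|/xK].
Qed.

Lemma sympl_srestr I (x y : 'rV[F]_(m + m)) : ssupp x \subset I ->
  sympl x (srestr I y) = sympl x y.
Proof.
move=> /ssupp_sub x0; apply: eq_bigr => i _.
rewrite /srestr row_mxKl row_mxKr !mxE; case: ifPn => // /x0[-> ->].
by rewrite !mul0r.
Qed.

End ShortenPuncture.

(** * The greedy column selection on a doubled matrix *)

Section Greedy.
Variables (F : finFieldType) (n r : nat) (B : 'M[F]_(r, n)).
Let BW := block_mx B 0 0 B.

Lemma col_diag_l l : col (lshift n l) BW = col_mx (col l B) 0.
Proof. by rewrite /BW block_mxEh colKl col_col_mx col0. Qed.

Lemma col_diag_r l : col (rshift n l) BW = col_mx 0 (col l B).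
Proof. by rewrite /BW block_mxEh colKr col_col_mx col0. Qed.

(** Projecting to the upper block kills the right-hand columns, and embedding as the upper block
    gives the converse. *)
Lemma in_col_span_diag_l l (P : {set 'I_n}) :
  in_col_span BW (lshift n l) (qudit_cols P) = (col l B \in cspan B P).
Proof.
rewrite /in_col_span col_diag_l; apply/idP/idP => [h|].
  rewrite -[col l B](col_mxKu _ (0 : 'cV_r)).
  apply: (linear_span_mem _ h) => _ /mapP[j jP ->]; move: jP; rewrite mem_enum.
  case: (split_ordP j) => k ->.
    by rewrite lshift_qudit_cols col_diag_l /= col_mxKu; apply: mem_cspan.
  by rewrite col_diag_r /= col_mxKu mem0v.
have cE (v : 'cV[F]_r) : col_mx v 0 = (col_mx 1%:M 0 : 'M_(r + r, r)) *m v.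
  by rewrite mul_col_mx mul1mx mul0mx.
rewrite cE; apply: linear_span_mem => _ /mapP[k kP ->].
rewrite mem_enum in kP.
by rewrite /= -cE -col_diag_l mem_cspan ?lshift_qudit_cols.
Qed.

(** The extra column [lshift n l] has zero lower block, so it cannot help to span a column that
    lives in the lower block. *)
Lemma in_col_span_diag_r l (P : {set 'I_n}) :
  in_col_span BW (rshift n l) (lshift n l |: qudit_cols P) =
    (col l B \in cspan B P).
Proof.
rewrite /in_col_span col_diag_r; apply/idP/idP => [h|].
  rewrite -[col l B](col_mxKd (0 : 'cV_r)).
  apply: (linear_span_mem _ h) => _ /mapP[j jP ->]; move: jP.
  rewrite mem_enum in_setU1; case/predU1P => [->|].
    by rewrite col_diag_l /= col_mxKd mem0v.
  case: (split_ordP j) => k ->.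
    by rewrite col_diag_l /= col_mxKd mem0v.
  by rewrite rshift_qudit_cols col_diag_r /= col_mxKd; apply: mem_cspan.
have cE (v : 'cV[F]_r) : col_mx 0 v = (col_mx 0 1%:M : 'M_(r + r, r)) *m v.
  by rewrite mul_col_mx mul1mx mul0mx.
rewrite cE; apply: linear_span_mem => _ /mapP[k kP ->].
rewrite mem_enum in kP.
by rewrite /= -cE -col_diag_r mem_cspan // in_setU1 rshift_qudit_cols kP orbT.
Qed.

Lemma qudit_colsU1 l (P : {set 'I_n}) :
  lshift n l |: (rshift n l |: qudit_cols P) = qudit_cols (l |: P).
Proof.
by rewrite /qudit_cols !imsetU1 setUACA setUA.
Qed.

(* On the doubled matrix diag(B, B) the two tests of the greedy step coincide
   with the single test on B, so P indexes a basis of the columns of B. *)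
Lemma greedy_diag (s : seq 'I_n) : exists P,
  [/\ greedy BW s = (P, qudit_cols P), {subset P <= s},
      (#|P| <= \dim (cspan B P))%N
    & {in s, forall l, col l B \in cspan B P}].
Proof.
elim/last_ind: s => [|s l [P [gP Ps fP sP]]].
  exists set0; split=> //; last by rewrite cards0.
    by rewrite /greedy /qudit_cols !imset0 setU0.
  by move=> i; rewrite inE.
rewrite /greedy foldl_rcons -/(greedy BW s) gP /=.
rewrite in_col_span_diag_l in_col_span_diag_r andbb.
have [lP|lP] := boolP (_ \in _); last first.
  exists (l |: P); split; first by rewrite qudit_colsU1.
  - move=> i /setU1P[->|/Ps iS]; by rewrite mem_rcons inE ?eqxx ?iS ?orbT.
  - rewrite cspanU1; apply: leq_trans (dim_span_adjoin lP).
    by rewrite cardsU1 -add1n leq_add ?leq_b1.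
  - move=> i; rewrite mem_rcons inE cspanU1 => /predU1P[->|/sP iP].
      by apply/(subvP (addvSl _ _))/memv_line.
    exact/(subvP (addvSr _ _)).
exists P; split=> // [i /Ps iS|i]; rewrite mem_rcons inE.
  by rewrite iS orbT.
by case/predU1P => [->|/sP].
Qed.

End Greedy.

(** * The sets and rows produced by the reduction procedure *)

Section ReductionProcedure.
Variables (F : finFieldType) (n N : nat) (CX CZ : {vspace 'rV[F]_n}).
Variables (I K : {set 'I_n}) (b : 'rV[F]_(n + n) -> 'rV[F]_N).
Variables (P J : {set 'I_n}) (O : {set 'rV[F]_N}).
Hypotheses (IK : I \subset K) (PJO : reduction CX CZ I K b P J O).

Let D := sdual (prod_code CX CZ).

Lemma rows_basis_mem r k (B : 'M[F]_(r, k)) S i :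
  rows_basis B S -> row i B \in S.
Proof. by move/basis_mem => h; apply/h/map_f; rewrite mem_enum. Qed.

Lemma rows_basis_dim r k (B : 'M[F]_(r, k)) S : rows_basis B S -> \dim S = r.
Proof.
by case/andP => /eqP <- /eqP ->; rewrite size_map size_enum_ord.
Qed.

(** As [D] is the product of the duals of [CZ] and [CX], a word in both duals may fill either half.
    Hence the rows of the doubled matrix lie in [D], and elimination stays inside the shortened
    dual. *)
Lemma diag_code_mem (u : 'rV[F]_n) :
  u \in short (K :\: I) (edual CX :&: edual CZ) ->
  row_mx u 0 \in sshort (K :\: I) D /\ row_mx 0 u \in sshort (K :\: I) D.
Proof.
case/shortP; rewrite memv_cap => /andP[uX uZ] u0.
split; apply/sshortP; rewrite /D sdual_prod_code mem_prod_code;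
  rewrite row_mxKl row_mxKr mem0v ?uX ?uZ; split=> //;
  by apply/ssupp_sub => i /u0 ui; rewrite row_mxEl row_mxEr mxE.
Qed.

Lemma diag_row_mem r (B : 'M[F]_(r, n)) i :
  rows_basis B (short (K :\: I) (edual CX :&: edual CZ)) ->
  row i (block_mx B 0 0 B) \in sshort (K :\: I) D.
Proof.
move=> bB; case: (split_ordP i) => k -> {i}.
  rewrite block_mxEv rowKu row_row_mx row0.
  by have [] := diag_code_mem (rows_basis_mem k bB).
rewrite block_mxEv rowKd row_row_mx row0.
by have [] := diag_code_mem (rows_basis_mem k bB).
Qed.

Lemma mulmx_row_mem r r' k (M : 'M[F]_(r', r)) (A : 'M[F]_(r, k))
    (S : {vspace 'rV[F]_k}) i :
  (forall j, row j A \in S) -> row i (M *m A) \in S.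
Proof.
by move=> AS; rewrite row_mul mulmx_sum_row memv_suml // => j _; rewrite rpredZ.
Qed.

Lemma reduction_card :
  [/\ #|P| = \dim (short (K :\: I) (edual CX :&: edual CZ)),
      P \subset K :\: I, J \subset K & [disjoint P & J]].
Proof.
case: PJO => rI rV rW V BI BV BWXZ s M /= defK _ bI bV bW ps.
have dW := rows_basis_dim bW.
have [Q [-> Qs fQ sQ]] := greedy_diag BWXZ s => /= Mz.
have sK l : (l \in s) = (l \in K :\: I) by rewrite (perm_mem ps) mem_enum.
have QKI : Q \subset K :\: I by apply/subsetP => l /Qs; rewrite sK.
(* The rows of [BWXZ] are independent, so all its columns span the full space. Columns outside
   [K :\: I] vanish, and those inside are in the span of the accepted ones. *)
have spanQ : cspan BWXZ Q = fullv.
  apply/eqP; rewrite eqEsubv subvf.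
  rewrite -(cspan_row_free (basis_row_free (basis_free bW))).
  apply/cspanP => l _; have [ls|] := boolP (l \in s); first exact: sQ.
  rewrite sK => lKI; rewrite (_ : col l _ = 0) ?mem0v //.
  apply/colP => i; rewrite !mxE.
  have /shortP[_ /(_ l lKI)] := rows_basis_mem i bW.
  by rewrite mxE.
have dQ : \dim (cspan BWXZ Q) = rW by rewrite spanQ dimvf /dim /= muln1.
split=> //.
- rewrite dW; apply/eqP; rewrite eqn_leq -{1}dQ fQ -dQ.
  by apply: leq_trans (dim_span _) _; rewrite size_map -cardE.
- rewrite subUset IK; apply/bigcupsP => i _.
  have : row i (BV - M *m (block_mx BWXZ 0 0 BWXZ)) \in sshort K D.
    rewrite linearB -defK rpredB //.
      exact/(subvP (addvSr _ _))/rows_basis_mem.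
    apply/(subvP (addvSl _ _))/(subvP (addvSr _ _))/mulmx_row_mem => j.
    exact: diag_row_mem.
  by case/sshortP.
(* An accepted [l] lies outside [I], and elimination has cleared both of its columns, so no reduced
   row has [l] in its support. *)
- apply/pred0P => l /=; apply/negP => /andP[lQ]; rewrite inE.
  have /setDP[_ lI] := subsetP QKI l lQ.
  rewrite (negPf lI) => /bigcupP[i _]; apply/negP/ssuppPn.
  have Mz0 j : j \in qudit_cols Q ->
      row i (BV - M *m block_mx BWXZ 0 0 BWXZ) 0 j = 0.
    by move/Mz/colP/(_ i); rewrite !mxE.
  by rewrite !Mz0 ?lshift_qudit_cols ?rshift_qudit_cols.
Qed.

(** [X] lists the rows of [BI] and of the reduced [BV]. It is kept as a sequence so that its length
    can be counted before any repetition is excluded. *)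
Lemma reduction_rows : exists X : seq 'rV[F]_(n + n),
  [/\ (<<X>> + sshort (K :\: I) D)%VS = sshort K D,
      (size X + \dim (sshort (K :\: I) D) = \dim (sshort K D))%N
    & O = [set b x | x in X]].
Proof.
case: PJO => rI rV rW V BI BV BWXZ s M /= defK dirK bI bV bW _ _.
set BVt := BV - _; set W := sshort (K :\: I) D in defK dirK *.
set X1 := [seq row i BI | i <- enum 'I_rI].
set X2 := [seq row i BVt | i <- enum 'I_rV].
(* Elimination alters the rows of [BV] only modulo [W], so the sum with [W] is unchanged. *)
have BVtE i : row i BVt - row i BV \in W.
  rewrite /BVt linearB /= addrC addKr rpredN.
  by apply: mulmx_row_mem => j; apply: diag_row_mem.
exists (X1 ++ X2); split.
- rewrite span_cat (span_basis bI) -defK.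
  rewrite -[RHS]addvA [(W + V)%VS]addvC -addvA; congr (_ + _)%VS.
  rewrite -(span_basis bV); apply/eqP; rewrite eqEsubv !subv_add !addvSr !andbT.
  apply/andP; split; apply/span_subvP => _ /mapP[i _ ->].
    rewrite -[row i BVt](subrK (row i BV)) addrC memv_add ?BVtE //.
    by apply/memv_span/map_f; rewrite mem_enum.
  rewrite -[row i BV](subrK (row i BVt)) addrC memv_add //.
    by apply/memv_span/map_f; rewrite mem_enum.
  by rewrite -opprB rpredN.
- rewrite size_cat size_map size_enum_ord size_map size_enum_ord.
  rewrite -defK (directvP dirK) /=.
  by rewrite (rows_basis_dim bI) (rows_basis_dim bV) addnAC.
- apply/setP => y; rewrite inE; apply/orP/imsetP => [|[x]].
    case=> /imsetP[i _ ->]; [exists (row i BI)|exists (row i BVt)] => //.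
      by rewrite mem_cat; apply/orP; left; apply/map_f; rewrite mem_enum.
    by rewrite mem_cat; apply/orP; right; apply/map_f; rewrite mem_enum.
  rewrite mem_cat => /orP[] /mapP[i _ ->] ->; [left|right];
  exact: imset_f.
Qed.

End ReductionProcedure.

(** * Observables of the entanglement-assisted extension *)

Section EntanglementAssisted.
Variables (F : finFieldType) (n c : nat).
Implicit Types (x e v : 'rV[F]_((n + c) + (n + c))) (u : 'rV[F]_(n + n)).

Lemma lshift_qfirst i : lshift c i \in qfirst n c.
Proof. exact: imset_f. Qed.

Lemma rshift_qfirst i : rshift n i \notin qfirst n c.
Proof. by apply/imsetP => -[j _ /eqP]; rewrite eq_rlshift. Qed.

Lemma sympl_firstq e x : ssupp e \subset qfirst n c ->
  sympl e x = sympl (firstq e) (firstq x).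
Proof.
move=> /ssupp_sub e0; rewrite [LHS]big_split_ord /= [X in _ + X]big1 => [|i _].
  rewrite addr0; apply: eq_bigr => i _.
  by rewrite /firstq !row_mxKl !row_mxKr !mxE.
by have [el er] := e0 _ (rshift_qfirst i); rewrite !mxE el er !mul0r subrr.
Qed.

Lemma imset_lshift_qfirst (I : {set 'I_n}) :
  [set lshift c i | i in I] \subset qfirst n c.
Proof. by apply/subsetP => _ /imsetP[i _ ->]; apply: lshift_qfirst. Qed.

Lemma ssupp_firstq e (I : {set 'I_n}) :
  ssupp e \subset [set lshift c i | i in I] -> ssupp (firstq e) \subset I.
Proof.
move=> /ssupp_sub e0; apply/ssupp_sub => i iI.
rewrite /firstq row_mxEl row_mxEr !mxE; apply: e0.
by rewrite mem_imset //; apply: lshift_inj.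
Qed.

(** Extends an error by zero on the decoder's qudits, which are free of errors. *)
Let pad u := beta (fun=> 0 : 'rV[F]_(c + c)) u.

Lemma ssupp_pad u (I : {set 'I_n}) :
  ssupp u \subset I -> ssupp (pad u) \subset [set lshift c i | i in I].
Proof.
move=> /ssupp_sub u0; apply/ssupp_sub => j.
case: (split_ordP j) => i ->; rewrite row_mxEl row_mxEr.
  rewrite mem_imset; last exact: lshift_inj.
  by rewrite !row_mxEl !mxE => /u0.
by rewrite !row_mxEr !mxE.
Qed.

Lemma qfirst_setT : c = 0%N -> qfirst n c = setT.
Proof.
move=> c0; apply/setP => j; rewrite inE; case: (split_ordP j) => i ->.
  by rewrite lshift_qfirst.
by have := ltn_ord i; rewrite {2}c0.
Qed.

Section Extension.
Variables (C : {vspace 'rV[F]_(n + n)}).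
Variables (Ce : {vspace 'rV[F]_((n + c) + (n + c))}).
Variable (alpha : 'rV[F]_(n + n) -> 'rV[F]_(c + c)).
Hypothesis Q_data : EA_extension C Ce alpha.

(* pi_n(C') contains both C and C^perp, and a dimension count leaves no room
   for anything else. *)
Lemma firstq_extension x : x \in Ce -> firstq x \in (C + sdual C)%VS.
Proof.
case: Q_data => dc; case: eqP => [_ CeE|_ [[dCe sCe pD sub] _]] xCe.
  by apply/(subvP (addvSl _ _)); rewrite -CeE.
pose Q : {vspace 'rV[F]_(n + n)} := (linfun (@firstq F n c) @: Ce)%VS.
have CDQ : (C + sdual C <= Q)%VS.
  by rewrite subv_add -{1}sCe -pD !limgS // capvSl.
have xQ : firstq x \in Q by apply/memv_imgP; exists x; rewrite ?lfunE.
suff /eqP -> : (C + sdual C)%VS == Q by [].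
rewrite eqEdim CDQ -(leq_add2r (\dim (C :&: sdual C))) dimv_sum_cap.
have dQ : (\dim Q <= \dim Ce)%N.
  by rewrite -(limg_ker_dim (linfun (@firstq F n c)) Ce) leq_addl.
apply: leq_trans (leq_add dQ (leqnn _)) _.
by rewrite dCe -addnA leq_add2l dc subnK ?dimvS ?capvSr.
Qed.

Lemma beta_sdual_extension u : u \in sdual C -> beta alpha u \in sdual Ce.
Proof.
case: Q_data => dc; case: eqP => [c0 CeE|_ [_ [_ _ sDE]]] uD; last first.
  by apply/sDE; exists u.
apply/sdualP => x; rewrite CeE => xC.
rewrite sympl_firstq ?qfirst_setT // firstq_beta.
by move/sdualP: uD; apply.
Qed.

Lemma sdual_extension_firstq e : ssupp e \subset qfirst n c ->
  e \in sdual Ce -> firstq e \in sdual (sdual C).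
Proof.
move=> es eD; case: Q_data => dc; case: eqP => [c0 CeE|_ [[_ _ pD sub] _]].
  (* For [c = 0] the vanishing truncated difference says that the dual is no larger than its
     intersection with [C], so the dual is contained in [C]. *)
  have DC : (sdual C <= C)%VS.
    suff /eqP <- : (C :&: sdual C)%VS == sdual C by apply: capvSl.
    by rewrite eqEdim capvSr /=; move: dc; rewrite c0; lia.
  apply/sdualP => u /(subvP DC) uC; rewrite symplC.
  rewrite -(firstq_beta (c := c) (fun=> 0) u).
  rewrite -sympl_firstq // symplC opprK.
  by move/sdualP: eD; apply; rewrite CeE firstq_beta.
(* For [c > 0], [u] lifts to some [v] in [sdual Ce], hence in [Ce]. The error is orthogonal to [v],
   and this product only sees the first [n] qudits. *)
apply/sdualP => u; rewrite -pD => /memv_imgP[v vD ->]; rewrite lfunE /=.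
rewrite symplC -sympl_firstq // symplC opprK -[LHS]opprK -symplC.
by rewrite (sdualP _ _ vD) ?oppr0 ?(subvP sub).
Qed.

(** With [S] spanned by the first parts of [T], errors on [I] orthogonal to [S] lie in the double
    dual of [C]. Complementing dimensions in [#|I| + #|I|] reverses this inclusion into a bound by
    the dimension of [spunct I S], which is at most [#|T|]. *)
Lemma erasure_observables_min (I : {set 'I_n}) T :
  erasure_observables I Ce T -> (\dim (spunct I (sdual C)) <= #|T|)%N.
Proof.
case=> TD Tcor; pose S := <<[seq firstq v | v <- enum T]>>%VS.
have sub : (sshort I (sdual S) <= sshort I (sdual (sdual C)))%VS.
  apply/subvP => u /sshortP[/sdualP uS uI]; apply/sshortP; split => //.
  have pI := ssupp_pad uI; have pq := subset_trans pI (imset_lshift_qfirst I).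
  rewrite -(firstq_beta (c := c) (fun=> 0) u).
  apply: sdual_extension_firstq => //.
  apply: Tcor => // v vT; rewrite sympl_firstq // firstq_beta symplC.
  by rewrite uS ?oppr0 // memv_span // map_f // mem_enum.
rewrite -(leq_add2l (\dim (sshort I (sdual (sdual C))))) dim_sshort_sdual.
rewrite -(dim_sshort_sdual I S) leq_add ?dimvS //.
have dS : (\dim (spunct I S) <= \dim S)%N.
  by rewrite -(limg_ker_dim (linfun (srestr I)) S) leq_addl.
apply: leq_trans dS (leq_trans (dim_span _) _).
by rewrite size_map -cardE.
Qed.

Lemma erasure_observables_suff (I K : {set 'I_n}) (X : seq 'rV[F]_(n + n)) :
  spunct I (C + sdual C) = spunct I (sshort K (sdual C)) ->
  (<<X>> + sshort (K :\: I) (sdual C))%VS = sshort K (sdual C) ->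
  erasure_observables I Ce [set beta alpha x | x in X].
Proof.
move=> repair genX; split=> [_ /imsetP[x xX ->]|e eI eX].
  apply: beta_sdual_extension.
  suff /sshortP[] : x \in sshort K (sdual C) by [].
  by rewrite -genX; apply/(subvP (addvSl _ _))/memv_span.
have eq := subset_trans eI (imset_lshift_qfirst I).
have fI := ssupp_firstq eI.
(* The generators in [X] are orthogonal to the error by assumption, and the summand supported on
   [K :\: I] does not meet its support. *)
have e_short u : u \in sshort K (sdual C) -> sympl (firstq e) u = 0.
  rewrite -genX => /memv_addP[y yX [z /sshortP[_ /ssupp_sub zK] ->]].
  rewrite linearD /=.
  have -> : sympl (firstq e) y = 0.
    apply/eqP; rewrite -memv0; apply: linear_span_mem yX => x xX.
    by rewrite /= -(firstq_beta alpha x) -sympl_firstq // eX ?imset_f ?memv0.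
  rewrite add0r -(sympl_srestr _ fI).
  suff /eqP -> : srestr I z == 0 by rewrite linear0.
  by apply/srestr_eq0 => i iI; apply: zK; rewrite inE iI.
(* The product with [x] depends only on the restriction of [firstq x] to [I]. By the repair
   property, a word of the dual supported on [K] has the same restriction. *)
apply/sdualP => x /firstq_extension xCD; rewrite symplC sympl_firstq //.
rewrite -(sympl_srestr _ fI).
have : srestr I (firstq x) \in spunct I (C + sdual C).
  by apply/spunctP; exists (firstq x).
rewrite repair => /spunctP[u uK ->].
by rewrite sympl_srestr // e_short // oppr0.
Qed.

End Extension.
End EntanglementAssisted.

(** * The bounds on [P] and [J], and the optimality of [O] *)

Lemma beta_inj (F : finFieldType) n c
    (alpha : 'rV[F]_(n + n) -> 'rV[F]_(c + c)) :
  injective (beta alpha).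
Proof. by move=> x y xy; rewrite -(firstq_beta alpha x) xy firstq_beta. Qed.

Theorem proposition4p1 (F : finFieldType) (n : nat) (hn : (2 <= n)%N)
    (CX CZ : {vspace 'rV[F]_n}) (C : {vspace 'rV[F]_(n + n)})
    (defC : C = prod_code CX CZ)
    (C_proper : C != fullv)
    (C_cap : (C :&: sdual C)%VS != C)
    (I K : {set 'I_n}) (I_neq0 : I != set0) (I_proper : I \proper K)
    (repair : spunct I (C + sdual C) = spunct I (sshort K (sdual C)))
    (c : nat) (Ce : {vspace 'rV[F]_((n + c) + (n + c))})
    (alpha : 'rV[F]_(n + n) -> 'rV[F]_(c + c))
    (Q_data : EA_extension C Ce alpha)
    (P J : {set 'I_n}) (O : {set 'rV[F]_((n + c) + (n + c))})
    (PJO : reduction CX CZ I K (beta alpha) P J O) :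
  [/\ #|K|%:Z - #|J|%:Z >= #|P|%:Z
        /\ #|P| = \dim (short (K :\: I) (edual CX :&: edual CZ)),
      #|J|%:Z - #|I|%:Z <=
        (\dim (punct K (CX + CZ)))%:Z - (\dim (short I (punct K (CX + CZ))))%:Z,
      CX = CZ -> CX != fullv ->
        #|J|%:Z - #|I|%:Z <=
          (\dim (punct K CX))%:Z - (\dim (short I (edual CX :&: CX)))%:Z,
      #|O| = \dim (spunct I (sdual C))
    & erasure_observables I Ce O /\
      forall T : {set 'rV[F]_((n + c) + (n + c))},
        erasure_observables I Ce T -> (#|O| <= #|T|)%N].
Proof.
have IK := proper_sub I_proper.
have [dP PK JK PJ] := reduction_card IK PJO.
have [X [genX sizeX defO]] := reduction_rows PJO.
rewrite -defC in genX sizeX.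
have KPJ : (#|P| + #|J| <= #|K|)%N.
  have <- : #|P :|: J| = (#|P| + #|J|)%N.
    by apply/eqP; rewrite (leq_card_setU P J).2.
  by rewrite subset_leq_card // subUset JK (subset_trans PK) ?subsetDl.
(* Duality on [K :\: I] gives [#|K :\: I| - #|P|] as the dimension of the sum punctured to
   [K :\: I]; the additive form avoids truncated subtraction. *)
have dJ : (#|J| + \dim (short I (punct K (CX + CZ))) <=
    #|I| + \dim (punct K (CX + CZ)))%N.
  have := dim_short_punct (CX + CZ)%VS IK.
  have := dim_short_edual (K :\: I) (CX + CZ)%VS.
  rewrite cardsD (setIidPr IK) edualD -dP.
  have := subset_leq_card IK.
  lia.
have dO : #|O| = \dim (spunct I (sdual C)).
  (* [X] has just as many entries as its span needs dimensions to complete [sshort K], so it is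
     free. With [beta] injective, no observable is counted twice. *)
  have uX : uniq X.
    apply: free_uniq; rewrite /free.
    rewrite eqn_leq dim_span /=.
    rewrite -(leq_add2r (\dim (sshort (K :\: I) (sdual C)))).
    by rewrite sizeX -genX; exact: leq_of_leqif (dimv_add_leqif _ _).
  rewrite defO card_imset; last exact: beta_inj.
  have -> : #|X| = size X by apply/card_uniqP.
  have := dim_sshortD I K (sdual C).
  (* The punctured dual lies between the two sides of the repair identity. *)
  have -> : spunct I (sdual C) = spunct I (sshort K (sdual C)).
    apply/eqP; rewrite eqEsubv -{1}repair !limgS ?addvSr //.
    by rewrite capvSl.
  lia.
split=> //.
- split=> //; lia.
- lia.
- move=> XZ _; rewrite -XZ addvv in dJ.
  (* Passing to this smaller shortened space can only enlarge the right-hand side of the general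
     bound. *)
  have : (short I (edual CX :&: CX) <= short I (punct K CX))%VS.
    apply: subv_trans (short_punct_sub _ IK).
    by apply: capvS; rewrite ?capvSr.
  move/dimvS; lia.
- split; first by rewrite defO; apply: erasure_observables_suff repair genX.
  by move=> T /(erasure_observables_min Q_data); rewrite dO.
Qed.
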